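(* Let $G$ be a finite simple undirected graph and $\delta\in[\gamma(G),1)$. Run the following procedure. Choose a maximum independent set $S$ of $G$ and label its vertices $1,2,\dots,|S|$. Let $L$ be the set of vertices of $G$ having exactly one neighbour in $S$. Initialize $x=\mathbf{1}_S$ and $\bar G=G$. For $i=1,2,\dots,|S|$ in turn: set $C_i=N_{\bar G}(i)\cap L$ and $\bar C_i=C_i\cup\{i\}$; set $x_j=\frac{1}{1+(|\bar C_i|-1)\delta}$ for all $j\in\bar C_i$; then replace $\bar G$ by its induced subgraph on $V(\bar G)\setminus(\bar C_i\cup N_{\bar G}(\bar C_i))$. Finally output $x$. Then the output $x$ is an independent clique solution of $\mathrm{LCP}_\delta(G)$ whose support is a union of $\alpha(G)$ pairwise independent cliques.
   Context: For a graph $G$ with adjacency matrix $A$ and $\delta>0$, $\mathrm{LCP}_\delta(G)$ is the problem: find $x\in\mathbb{R}^{V(G)}$ with $x\ge0$, $(I+\delta A)x-\mathbf{e}\ge 0$, $x^\top((I+\delta A)x-\mathbf{e})=0$ ($\mathbf{e}$ the all-ones vector). $N_H(v)$ is the neighbourhood of $v$ in $H$; $N_H(K)=\bigcup_{v\in K}N_H(v)\setminus K$. $\mathbf{1}_S$ is the characteristic vector of $S$. Two cliques are independent if no vertex of one is adjacent to any vertex of the other. An independent clique solution (ICS) of $\mathrm{LCP}_\delta(G)$ is a solution whose support $\sigma(x)=\{i:x_i>0\}$ is a union of pairwise independent (nonempty) cliques. $\alpha(G)$ is the independence number, $\omega(G)$ the clique number, and $\gamma(G)=\frac{\omega(G)-3+\sqrt{(\omega(G)-3)^2+4(\omega(G)-1)}}{2(\omega(G)-1)}$.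 *)

(* Defs.v *)
From HB Require Import structures.
From mathcomp Require Import all_boot all_order all_algebra.
From mathcomp Require Import reals.

Set Implicit Arguments.
Unset Strict Implicit.
Unset Printing Implicit Defensive.

Import Order.TTheory GRing.Theory Num.Theory.
Local Open Scope ring_scope.

(* A simple graph on the vertex type V is a symmetric irreflexive e : rel V.
   Vectors of R^V are {ffun V -> R}, and V-indexed square matrices are
   functions V -> V -> R. *)

Section Graphs.
Variables (V : finType).
Implicit Types (e h : rel V) (S K B : {set V}).

(* The subgraph induced on B, on the ambient type V: vertices outside B are
   kept as isolated points, which belong to no neighbourhood. *)
Definition induced e B : rel V := [rel u v | [&& u \in B, v \in B & e u v]].

Definition nbh h v : {set V} := [set u | h v u].

Definition nbhs h K : {set V} := (\bigcup_(v in K) nbh h v) :\: K.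

Definition independent_set e S : bool :=
  [forall u in S, forall v in S, ~~ e u v].

Definition clique e K : bool :=
  [forall u in K, forall v in K, (u != v) ==> e u v].

Definition alpha e : nat := (\max_(S : {set V} | independent_set e S) #|S|)%N.

Definition omega e : nat := (\max_(K : {set V} | clique e K) #|K|)%N.

Definition maximum_independent_set e S : bool :=
  independent_set e S && (#|S| == alpha e).

Definition independent_from e K1 K2 : bool :=
  [forall u in K1, forall v in K2, ~~ e u v].

(* Distinct members of such a family are automatically disjoint: a vertex of
   K1 outside K2 would be adjacent to any common vertex. *)
Definition independent_cliques e (P : {set {set V}}) : Prop :=
  (forall K, K \in P -> K != set0 /\ clique e K) /\
  (forall K1 K2, K1 \in P -> K2 \in P -> K1 != K2 -> independent_from e K1 K2).

End Graphs.

Section LCP.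
Variables (R : realType) (V : finType).
Implicit Types (e : rel V) (delta : R) (x : {ffun V -> R}).

Definition adjacency e : V -> V -> R := fun u v => (e u v)%:R.

Definition id_plus_adj e delta : V -> V -> R :=
  fun u v => (u == v)%:R + delta * adjacency e u v.

Definition mulmv (M : V -> V -> R) x : {ffun V -> R} :=
  [ffun u => \sum_v M u v * x v].

(* The vector (I + delta A) x - e, with e the all-ones vector. *)
Definition lcp_residual e delta x : {ffun V -> R} :=
  [ffun u => mulmv (id_plus_adj e delta) x u - 1].

Definition LCP_solution e delta x : Prop :=
  [/\ forall v, 0 <= x v,
      forall v, 0 <= lcp_residual e delta x v
    & \sum_v x v * lcp_residual e delta x v = 0].

Definition supp x : {set V} := [set v | 0 < x v].

Definition independent_clique_solution e delta x : Prop :=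
  LCP_solution e delta x /\
  exists P : {set {set V}}, independent_cliques e P /\ supp x = cover P.

(* For omega e = 1 (edgeless graph) the quotient is 0 / 0, which is 0 here:
   the bound gamma e <= delta is then vacuous for delta > 0. *)
Definition gamma e : R :=
  let w : R := (omega e)%:R in
  (w - 3 + Num.sqrt ((w - 3) ^+ 2 + 4 * (w - 1))) / (2 * (w - 1)).

Definition indicator (S : {set V}) : {ffun V -> R} := [ffun v => (v \in S)%:R].

Definition one_neighbour_in e (S : {set V}) : {set V} :=
  [set v | #|nbh e v :&: S| == 1%N].

(* One pass of the loop, at vertex i. The state consists of the vertex set B
   of the current induced subgraph of e and of the current vector. *)
Definition step e delta (L : {set V}) (st : {set V} * {ffun V -> R}) (i : V) :
    {set V} * {ffun V -> R} :=
  let: (B, x) := st in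
  let H := induced e B in
  let C := nbh H i :&: L in
  let Cbar := i |: C in
  (B :\: (Cbar :|: nbhs H Cbar),
   [ffun j => if j \in Cbar then 1 / (1 + (#|Cbar|%:R - 1) * delta) else x j]).

(* The labelling of S is the sequence s listing its vertices in order. *)
Definition procedure e delta (S : {set V}) (s : seq V) : {ffun V -> R} :=
  (foldl (step e delta (one_neighbour_in e S)) ([set: V], indicator S) s).2.

End LCP.

(* Main.v *)
(** The clique built at step i meets S only in i, and each of its other
    vertices has i as its only neighbour in S.  Distinct cliques are independent,
    so one vertex from each gives another maximum independent set; hence
    a vertex v outside the support is adjacent to every vertex of some clique.
    It also has a neighbour in a second clique: either v has another neighbour
    in S, or v lies in L and was deleted before step i because of an earlier
    clique.  The full clique contributes m/(1+(m-1) delta) >= 1 to the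
    neighbourhood sum of v, the second one at least 1/(1+(omega-1) delta), and
    delta >= gamma says exactly that
    delta (1 + 1/(1+(omega-1) delta)) >= 1. *)

Require Import Defs.
From HB Require Import structures.
From mathcomp Require Import all_boot all_order all_algebra.
From mathcomp Require Import reals lra ring.

Set Implicit Arguments.
Unset Strict Implicit.
Unset Printing Implicit Defensive.

Import Order.TTheory GRing.Theory Num.Theory.
Local Open Scope ring_scope.

(** * The threshold [gamma] and the value carried by a clique *)

(** For [w = omega e > 1], [gamma] is the larger root of this quadratic in [delta], whose leading
    coefficient is positive. *)
Lemma quadratic_of_gamma_le (R : realType) (V : finType) (e : rel V) (delta : R) :
  (1 < omega e)%N -> gamma R e <= delta ->
  0 <= ((omega e)%:R - 1) * delta ^+ 2 - ((omega e)%:R - 3) * delta - 1.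
Proof.
rewrite /gamma -(ltr_nat R); move: (omega e)%:R => w w_gt1.
set D := _ ^+ 2 + _.
have D_ge0 : 0 <= D by rewrite /D addr_ge0 ?sqr_ge0 //; lra.
rewrite ler_pdivrMr; last by lra.
move=> le_delta.
have sD := sqr_sqrtr D_ge0.
have s_ge0 := sqrtr_ge0 D.
have: Num.sqrt D ^+ 2 <= (delta * (2 * (w - 1)) - (w - 3)) ^+ 2.
  by rewrite lerXn2r // ?nnegrE; lra.
rewrite sD /D => sq_le.
(* Completing the square: this product is the difference of the two sides of [sq_le]. *)
suff: 0 <= 4 * (w - 1) * ((w - 1) * delta ^+ 2 - (w - 3) * delta - 1).
  by rewrite pmulr_rge0 //; lra.
move: sq_le; rewrite -subr_ge0; congr (0 <= _); ring.
Qed.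

(** The constant value that solves the LCP equations with equality on an isolated clique of [m]
    vertices. *)
Definition clique_weight (R : realType) (delta : R) (m : nat) : R :=
  1 / (1 + (m%:R - 1) * delta).

Section CliqueWeight.
Variables (R : realType) (delta : R).
Hypotheses (delta_gt0 : 0 < delta) (delta_lt1 : delta < 1).

Lemma weight_den_gt0 m : (0 < m)%N -> 0 < 1 + (m%:R - 1) * delta.
Proof.
move=> m_gt0; have: 1 <= m%:R :> R by rewrite ler1n.
by move=> ?; rewrite ltr_pwDl // mulr_ge0 ?(ltW delta_gt0) // subr_ge0.
Qed.

Lemma clique_weight_gt0 m : (0 < m)%N -> 0 < clique_weight delta m.
Proof. by move=> m_gt0; rewrite divr_gt0 ?weight_den_gt0. Qed.

Lemma clique_weight_eq m : (0 < m)%N ->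
  clique_weight delta m + delta * (clique_weight delta m *+ m.-1) = 1.
Proof.
case: m => // m _; have := weight_den_gt0 (ltn0Sn m).
rewrite /clique_weight /= -[_ *+ m]mulr_natr -natr1 addrK => d_gt0.
by field; apply: lt0r_neq0.
Qed.

(** The numerator exceeds the denominator by [(m - 1) * (1 - delta)], nonnegative because
    [delta < 1]. *)
Lemma clique_weight_total_ge1 m : (0 < m)%N -> 1 <= clique_weight delta m *+ m.
Proof.
move=> m_gt0; rewrite -mulr_natr mulrAC mul1r ler_pdivlMr ?weight_den_gt0 //.
have m_ge1 : 1 <= m%:R :> R by rewrite ler1n.
have : 0 <= (m%:R - 1) * (1 - delta) by rewrite mulr_ge0 // subr_ge0 // ltW.
by lra.
Qed.

Lemma clique_weight_anti m n : (0 < m <= n)%N ->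
  clique_weight delta n <= clique_weight delta m.
Proof.
case/andP=> m_gt0 le_mn; have n_gt0 := leq_trans m_gt0 le_mn.
rewrite /clique_weight !div1r lef_pV2 ?posrE ?weight_den_gt0 //.
by rewrite lerD2l ler_wpM2r ?(ltW delta_gt0) // lerD2r ler_nat.
Qed.

(** Multiplying by the denominator of the weight turns this into the quadratic inequality. *)
Lemma one_plus_clique_weight (V : finType) (e : rel V) :
  (1 < omega e)%N -> gamma R e <= delta ->
  1 <= delta * (1 + clique_weight delta (omega e)).
Proof.
move=> w_gt1 /(quadratic_of_gamma_le w_gt1) quad.
have d_gt0 := weight_den_gt0 (ltnW w_gt1).
rewrite -(ler_pM2r d_gt0) -mulrA [(1 + clique_weight _ _) * _]mulrDl /clique_weight divfK ?gt_eqF //.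
by move: quad; nra.
Qed.

End CliqueWeight.

(** * Maximum independent sets and families of cliques rooted in them *)

Section Packing.
Variables (V : finType) (e : rel V) (S : {set V}).
Hypotheses (e_sym : symmetric e) (e_irr : irreflexive e).
Hypothesis S_max : maximum_independent_set e S.

Local Notation L := (one_neighbour_in e S).

Lemma independentP (A : {set V}) :
  reflect {in A &, forall u v, ~~ e u v} (independent_set e A).
Proof.
apply: (iffP forall_inP) => [h u v uA vA|h u uA].
  by move/forall_inP: (h u uA); apply.
by apply/forall_inP => v; apply: h.
Qed.

Lemma cliqueP (A : {set V}) :
  reflect {in A &, forall u v, u != v -> e u v} (clique e A).
Proof.
apply: (iffP forall_inP) => [h u v uA vA|h u uA].
  by move/forall_inP: (h u uA) => /(_ v vA)/implyP.
by apply/forall_inP => v vA; apply/implyP; apply: h.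
Qed.

Lemma clique_card_le (A : {set V}) : clique e A -> (#|A| <= omega e)%N.
Proof. exact: leq_bigmax_cond. Qed.

Lemma edge_omega_gt1 u v : e u v -> (1 < omega e)%N.
Proof.
move=> e_uv; have neq_uv : u != v by apply: contraTneq e_uv => ->; rewrite e_irr.
suff : (#|[set u; v]| <= omega e)%N by rewrite cards2 neq_uv.
apply/clique_card_le/cliqueP => a b; rewrite !inE.
by do 2![case/orP => /eqP->] => //; rewrite ?eqxx // e_sym.
Qed.

Lemma S_edge i j : i \in S -> j \in S -> e i j = false.
Proof.
case/andP: S_max => /independentP h _ iS jS; exact/negbTE/h.
Qed.

Lemma independent_card_le (A : {set V}) : independent_set e A -> (#|A| <= #|S|)%N.
Proof. by case/andP: S_max => _ /eqP->; apply: leq_bigmax_cond. Qed.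

Lemma L_unique v i j : v \in L -> i \in S -> j \in S -> e v i -> e v j -> i = j.
Proof.
rewrite inE => /cards1P[k /setP Nv] iS jS vi vj.
have in_k w : w \in S -> e v w -> w = k.
  by move=> wS vw; apply/set1P; rewrite -Nv !inE vw wS.
exact: etrans (in_k i iS vi) (esym (in_k j jS vj)).
Qed.

(* [K i] stands for the clique of [i], for the vertices [i] of [A], a part of
   [S] that the procedure has already treated. *)
Record packing (A : {set V}) (K : V -> {set V}) : Prop := Packing {
  packing_mem : {in A, forall i, i \in K i};
  packing_sub : {in A, forall i w, w \in K i -> w = i \/ e i w /\ w \in L};
  packing_indep : {in A &, forall i j, i != j ->
    {in K i & K j, forall u w, e u w = false}};
  packing_removed : {in A, forall i w, w \in L -> e i w -> w \notin K i ->
    exists2 k, (k \in A) && (k != i) &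
      w \in K k \/ exists2 u, u \in K k & e u w}
}.

(** * Cliques of a partial packing *)

Section Theory.
Variables (A : {set V}) (K : V -> {set V}).
Hypotheses (subAS : A \subset S) (packK : packing A K).

(** Apart from [i] itself, [K i] consists of neighbours of [i] in [L], so [i] is the only vertex of
    [S] equal or adjacent to any of its members. *)
Lemma packing_S i j w :
  i \in A -> w \in K i -> j \in S -> (w == j) || e w j -> i = j.
Proof.
move=> iA wK jS; have iS := subsetP subAS i iA.
case: (packing_sub packK iA wK) => [->|[e_iw wL]].
  by rewrite S_edge // orbF => /eqP.
case/orP=> [/eqP eq_wj|]; first by rewrite eq_wj S_edge in e_iw.
by apply: L_unique wL iS jS _; rewrite e_sym.
Qed.

Lemma packing_inj i j w : i \in A -> j \in A -> w \in K i -> w \in K j -> i = j.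
Proof.
move=> iA jA wKi wKj; have jS := subsetP subAS j jA.
apply: (packing_S iA wKi jS).
by case: (packing_sub packK jA wKj) => [->|[]]; rewrite ?eqxx // e_sym orbC => ->.
Qed.

(* Two non-adjacent vertices of [K i] could replace [i] in [S]. *)
Lemma packing_clique i : i \in A -> clique e (K i).
Proof.
move=> iA; apply/cliqueP => u w uK wK neq_uw.
have iS := subsetP subAS i iA.
case: (packing_sub packK iA uK) (packing_sub packK iA wK) => [eq_ui|[iu uL]].
  by rewrite eq_ui => -[eq_wi|[]//]; rewrite eq_ui eq_wi eqxx in neq_uw.
case=> [->|[iw wL]]; first by rewrite e_sym.
apply: contraT => n_uw.
(* Neighbours of [i] lie outside [S], so the exchange really gains two vertices for one. *)
have off z : e i z -> z \notin S by apply: contraTN => zS; rewrite S_edge.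
have offN z j : z \in K i -> j \in S :\ i -> e z j = false.
  move=> zK /setD1P[neq_ji jS]; apply: contra_neqF neq_ji => e_zj.
  by apply/esym/(packing_S iA zK jS); rewrite e_zj orbT.
have indep : independent_set e (u |: (w |: S :\ i)).
  apply/independentP => a b; rewrite !in_setU1.
  case/or3P=> [/eqP->|/eqP->|aS] /or3P[/eqP->|/eqP->|bS].
  - by rewrite e_irr.
  - by [].
  - by rewrite offN.
  - by rewrite e_sym.
  - by rewrite e_irr.
  - by rewrite offN.
  - by rewrite e_sym offN.
  - by rewrite e_sym offN.
  by rewrite S_edge // (subsetP (subD1set S i)).
have := independent_card_le indep.
rewrite !cardsU1 !inE (negPf neq_uw) (negPf (off u iu)) (negPf (off w iw)) !andbF /=.
by rewrite (cardsD1 i S) iS ltnn.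
Qed.

End Theory.

(** * Vertices outside all cliques of a complete packing *)

Section Full.
Variable K : V -> {set V}.
Hypothesis packK : packing S K.

(* Otherwise one non-neighbour of [v] chosen in each clique, together with [v]
   itself, would form an independent set larger than [S]. *)
Lemma packing_full v : (forall i, i \in S -> v \notin K i) ->
  exists2 i, i \in S & {in K i, forall w, e v w}.
Proof.
move=> v_off.
case: (boolP [exists i in S, K i \subset nbh e v]) => [/exists_inP[i iS /subsetP sub]|].
  by exists i => // w /sub; rewrite inE.
rewrite negb_exists_in => /forall_inP not_full.
(* The default [i] is never reached for [i] in [S], by [not_full]. *)
pose f i := odflt i [pick w in K i | ~~ e v w].
have fP i : i \in S -> f i \in K i /\ ~~ e v (f i).
  move=> iS; rewrite /f; case: pickP => [w /andP[]//|none] /=.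
  case/negP: (not_full i iS); apply/subsetP => w wK; rewrite inE.
  by have := none w; rewrite /= wK /= => /negbFE.
have f_inj : {in S &, injective f}.
  move=> i j iS jS eq_f; have [fi _] := fP i iS; have [fj _] := fP j jS.
  by apply: (packing_inj (subxx S) packK iS jS fi); rewrite eq_f.
have indep : independent_set e (v |: f @: S).
  apply/independentP => a b; rewrite !in_setU1.
  case/orP=> [/eqP->|/imsetP[i iS ->]] /orP[/eqP->|/imsetP[j jS ->]].
  - by rewrite e_irr.
  - by case: (fP j jS).
  - by rewrite e_sym; case: (fP i iS).
  have [->|neq_ij] := eqVneq i j; first by rewrite e_irr.
  by rewrite (packing_indep packK iS jS neq_ij) //; [case: (fP i iS)|case: (fP j jS)].
have := independent_card_le indep.
rewrite cardsU1 card_in_imset // (_ : v \notin _) ?ltnn //.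
apply/imsetP => -[i iS eq_v]; case/negP: (v_off i iS).
by rewrite eq_v; case: (fP i iS).
Qed.

(** Supplies the extra term that, added to a full clique, lifts the neighbourhood sum of [v] high
    enough. *)
Lemma packing_second v i : (forall j, j \in S -> v \notin K j) ->
  i \in S -> e v i ->
  exists2 k, (k \in S) && (k != i) & exists2 u, u \in K k & e v u.
Proof.
move=> v_off iS e_vi; case: (boolP (v \in L)) => [vL|].
  have [|k kS_neq] := packing_removed packK iS vL _ (v_off i iS).
    by rewrite e_sym.
  have /andP[kS _] := kS_neq.
  (* Since [v] lies in no clique, it must be adjacent to a member of [K k]. *)
  case=> [/idPn|[u uK e_uv]]; first by rewrite v_off.
  by exists k => //; exists u; rewrite // e_sym.
rewrite inE => not1.
case: (set_0Vmem ((nbh e v :&: S) :\ i)) => [none|[j]].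
  case/negP: not1; apply/eqP.
  by rewrite (cardsD1 i) none cards0 !inE e_vi iS.
rewrite !inE => /and3P[neq_ji e_vj jS].
by exists j; rewrite ?jS //; exists j => //; apply: packing_mem packK _ jS.
Qed.

End Full.

(** * The loop invariant *)

Section Procedure.
Variables (R : realType) (delta : R).

(** The state does not record the cliques, so [K] is carried as a witness. [inv_in] and [inv_notin]
    together say that the current graph consists exactly of the vertices neither in nor adjacent to
    a finished clique. *)
Record invariant (A : {set V}) (K : V -> {set V})
    (st : {set V} * {ffun V -> R}) : Prop := Invariant {
  inv_sub : A \subset S;
  inv_packing : packing A K;
  inv_in : forall u, u \in st.1 ->
    {in A, forall i, {in K i, forall w, (u != w) && ~~ e w u}};
  inv_notin : forall u, u \notin st.1 ->
    exists2 k, k \in A & u \in K k \/ exists2 w, w \in K k & e w u;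
  inv_on : {in A, forall i, {in K i, forall u, st.2 u = clique_weight delta #|K i|}};
  inv_off : forall u, (forall i, i \in A -> u \notin K i) -> st.2 u = (u \in S)%:R
}.

(** The new clique is taken inside the current graph, which [inB] keeps apart from all earlier
    cliques. *)
Lemma invariant_step A K st i : invariant A K st -> i \in S -> i \notin A ->
  exists K', invariant (i |: A) K' (step e delta L st i).
Proof.
case: st => B x [/= subAS packK inB notinB onK offK] iS iNA.
set C := i |: (nbh (induced e B) i :&: L).
(* Had [i] been deleted, it would lie in or next to some [K k] with [k] in [A], forcing [k = i] by
   [packing_S]. *)
have iB : i \in B.
  apply: contraR iNA => /notinB[k kA iK].
  suff <- : k = i by [].
  case: iK => [iK|[w wK e_wi]].
    by apply: (packing_S subAS packK kA iK iS); rewrite eqxx.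
  by apply: (packing_S subAS packK kA wK iS); rewrite e_wi orbT.
have inC u : (u \in C) = (u == i) || [&& u \in B, e i u & u \in L].
  have inN : (u \in nbh (induced e B) i) = (u \in B) && e i u.
    by rewrite inE /induced /= iB.
  by rewrite in_setU1 in_setI inN -andbA.
have subCB u : u \in C -> u \in B by rewrite inC => /orP[/eqP->|/and3P[]].
pose K' j := if j == i then C else K j.
have K'i : K' i = C by rewrite /K' eqxx.
have K'A j : j \in A -> K' j = K j.
  by rewrite /K'; case: eqP => // ->; rewrite (negPf iNA).
have neqA j : j \in A -> j != i by apply: contraTneq => ->.
have apart j u w : j \in A -> u \in C -> w \in K j -> e w u = false.
  by move=> jA /subCB/inB/(_ j jA w)h /h/andP[_ /negPf].
exists K'; split => /=.
- by rewrite subUset sub1set iS.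
- split.
  + move=> j /setU1P[->|jA]; first by rewrite K'i setU11.
    by rewrite K'A // (packing_mem packK).
  + move=> j /setU1P[->|jA] w.
      by rewrite K'i inC => /orP[/eqP|/and3P[]]; [left|right].
    by rewrite K'A //; apply: packing_sub packK _ jA _.
  + move=> j k /setU1P[->|jA] /setU1P[->|kA] neq_jk u w.
    * by rewrite eqxx in neq_jk.
    * by rewrite K'i K'A // => uC wK; rewrite e_sym; apply: apart kA uC wK.
    * by rewrite K'i K'A // => uK wC; apply: apart jA wC uK.
    * by rewrite !K'A //; apply: packing_indep packK _ _ jA kA neq_jk _ _.
  (* A neighbour of [i] in [L] missed by [C] has already left [B], and [notinB] names the earlier
     clique responsible. *)
  + move=> j /setU1P[->|jA] w wL e_jw.
      rewrite K'i inC e_jw wL !andbT negb_or => /andP[_ /notinB[k kA wk]].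
      by exists k; rewrite ?K'A // in_setU1 kA orbT neqA.
    rewrite K'A // => wK.
    have [k /andP[kA neq_kj] wk] := packing_removed packK jA wL e_jw wK.
    by exists k; rewrite ?K'A // in_setU1 kA orbT neq_kj.
- move=> u /setDP[uB]; rewrite in_setU negb_or => /andP[uC].
  rewrite in_setD uC /= => uN j /setU1P[->|jA] w; last by rewrite K'A //; apply: inB.
  rewrite K'i => wC; apply/andP; split; first by apply: contraNneq uC => ->.
  (* Both ends lie in [B], so the edge survives in the induced subgraph and [u] would be deleted. *)
  apply: contra uN => e_wu; apply/bigcupP; exists w => //.
  by rewrite inE /induced /= (subCB w wC) uB.
- move=> u; rewrite in_setD negb_and negbK => /orP[|/notinB[k kA uk]]; last first.
    by exists k; rewrite ?K'A // in_setU1 kA orbT.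
  case/setUP=> [uC|/setDP[/bigcupP[w wC]]]; first by exists i; rewrite ?setU11 // K'i; left.
  rewrite inE /induced /= => /and3P[_ _ e_wu] _.
  by exists i; rewrite ?setU11 // K'i; right; exists w.
- move=> j /setU1P[->|jA] u; rewrite ?K'i ?K'A // ffunE; first by move->.
  (* Values on earlier cliques are never overwritten, since their vertices have left [B]. *)
  move=> uK; case: ifP => [uC|_]; last exact: onK uK.
  by have := inB u (subCB u uC) j jA u uK; rewrite eqxx.
- move=> u uN; rewrite ffunE.
  have /negPf-> : u \notin C by rewrite -K'i uN ?setU11.
  by apply: offK => j jA; rewrite -K'A // uN // in_setU1 jA orbT.
Qed.

Lemma invariant_foldl s A K st : invariant A K st -> uniq s ->
  {subset s <= S} -> {in s, forall i, i \notin A} ->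
  exists K', invariant (A :|: [set i in s]) K' (foldl (step e delta L) st s).
Proof.
elim: s A K st => [|i s IHs] A K st invK /=.
  by exists K; rewrite (_ : [set i in [::]] = set0) ?setU0 //; apply/setP => i; rewrite !inE.
case/andP=> i_s s_uniq subS sNA.
have [||K' invK'] := invariant_step invK (_ : i \in S) (_ : i \notin A).
- by apply: subS; rewrite mem_head.
- by apply: sNA; rewrite mem_head.
have -> : A :|: [set j in i :: s] = (i |: A) :|: [set j in s].
  by apply/setP => j; rewrite !inE; case: (j == i); rewrite /= ?orbT.
apply: IHs invK' s_uniq _ _ => j j_s; first by apply: subS; rewrite inE j_s orbT.
rewrite in_setU1 negb_or sNA ?inE ?j_s ?orbT // andbT.
by apply: contraNneq i_s => <-.
Qed.

Lemma invariant_start K : invariant set0 K ([set: V], indicator R S).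
Proof.
split=> /=.
- exact: sub0set.
- by split=> i; rewrite inE.
- by move=> u _ i; rewrite inE.
- by move=> u; rewrite inE.
- by move=> i; rewrite inE.
- by move=> u _; rewrite ffunE.
Qed.

Lemma procedure_packing s : perm_eq s (enum S) ->
  let x := procedure e delta S s in
  exists K, [/\ packing S K,
    {in S, forall i, {in K i, forall u, x u = clique_weight delta #|K i|}} &
    forall u, (forall i, i \in S -> u \notin K i) -> x u = 0].
Proof.
move=> s_enum; have s_S : [set i in s] = S.
  by apply/setP => i; rewrite inE (perm_mem s_enum) mem_enum.
have [|||K] := invariant_foldl (s := s) (invariant_start (fun i => [set i])).
- by rewrite (perm_uniq s_enum) enum_uniq.
- by move=> i; rewrite (perm_mem s_enum) mem_enum.
- by move=> i _; rewrite inE.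
rewrite set0U s_S => -[_ packK _ _ onK offK]; exists K; split=> // u uN.
(* Each vertex of [S] lies in its own clique, so no initial value 1 survives outside the cliques. *)
rewrite [LHS]offK //; case: (boolP (u \in S)) => // uS.
by case/negP: (uN u uS); apply: packing_mem packK _ uS.
Qed.

End Procedure.

(** * Verification of the LCP conditions *)

Section Solution.
Variables (R : realType) (delta : R).
Hypotheses (delta_gt0 : 0 < delta) (delta_lt1 : delta < 1).
Hypothesis gamma_le_delta : gamma R e <= delta.
Variables (K : V -> {set V}) (x : {ffun V -> R}).
Hypothesis packK : packing S K.
Hypothesis x_on :
  {in S, forall i, {in K i, forall u, x u = clique_weight delta #|K i|}}.
Hypothesis x_off : forall u, (forall i, i \in S -> u \notin K i) -> x u = 0.

Lemma packing_case u :
  (exists2 i, i \in S & u \in K i) \/ (forall i, i \in S -> u \notin K i).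
Proof.
case: (boolP [exists i in S, u \in K i]) => [/exists_inP|]; first by left.
by rewrite negb_exists_in => /forall_inP; right.
Qed.

Lemma x_on_gt0 i u : i \in S -> u \in K i -> 0 < x u.
Proof.
move=> iS uK; rewrite (x_on iS uK) clique_weight_gt0 //.
by apply/card_gt0P; exists u.
Qed.

Lemma x_ge0 u : 0 <= x u.
Proof.
by case: (packing_case u) => [[i iS /(x_on_gt0 iS)/ltW]//|/x_off->].
Qed.

Lemma supp_cover : supp x = cover (K @: S).
Proof.
rewrite cover_imset; apply/setP => u; rewrite inE; apply/idP/bigcupP.
  by case: (packing_case u) => [[i iS uK]|/x_off->]; [exists i|rewrite ltxx].
by case=> i iS; apply: x_on_gt0 iS.
Qed.

Lemma independent_cliques_packing : independent_cliques e (K @: S).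
Proof.
split=> [_ /imsetP[i iS ->]|_ _ /imsetP[i iS ->] /imsetP[j jS ->] neqK].
  split; last exact: packing_clique (subxx S) packK _ iS.
  by apply/set0Pn; exists i; apply: packing_mem packK _ iS.
apply/forall_inP => u uK; apply/forall_inP => w wK.
by rewrite (packing_indep packK iS jS _ uK wK) //; apply: contraNneq neqK => ->.
Qed.

Lemma card_packing : #|K @: S| = alpha e.
Proof.
case/andP: S_max => _ /eqP<-; apply: card_in_imset => i j iS jS eqK.
apply: (packing_inj (subxx S) packK iS jS (packing_mem packK iS)).
by rewrite -eqK; apply: packing_mem packK _ iS.
Qed.

Lemma lcp_residualE u :
  lcp_residual e delta x u = x u + delta * (\sum_(v | e u v) x v) - 1.
Proof.
rewrite !ffunE; congr (_ - 1).
under eq_bigr do rewrite /id_plus_adj mulrDl -mulrA.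
rewrite big_split /= -mulr_sumr; congr (_ + _ * _).
  rewrite (bigD1 u) //= eqxx mul1r big1 ?addr0 // => v /negPf neq_vu.
  by rewrite eq_sym neq_vu mul0r.
rewrite [RHS]big_mkcond; apply: eq_bigr => v _.
by rewrite /adjacency; case: (e u v); rewrite ?mul1r ?mul0r.
Qed.

Lemma lcp_residual_on i u : i \in S -> u \in K i -> lcp_residual e delta x u = 0.
Proof.
move=> iS uK; apply/eqP; rewrite lcp_residualE subr_eq0; apply/eqP.
(* Distinct cliques are independent and [x] vanishes off them, so only the rest of [K i]
   contributes. *)
have -> : \sum_(v | e u v) x v = \sum_(v in K i :\ u) x v.
  rewrite big_mkcond [RHS]big_mkcond; apply: eq_bigr => v _.
  rewrite in_setD1; have [vK|vNK] := boolP (v \in K i).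
    have [->|neq_vu] := eqVneq v u; first by rewrite e_irr.
    have /cliqueP := packing_clique (subxx S) packK iS.
    by move=> /(_ u v uK vK) ->; rewrite // eq_sym.
  rewrite andbF; case: ifP => // e_uv.
  case: (packing_case v) => [[j jS vK]|/x_off//].
  have neq_ij : i != j by apply: contraNneq vNK => ->.
  by rewrite (packing_indep packK iS jS neq_ij uK vK) in e_uv.
rewrite (eq_bigr (fun=> clique_weight delta #|K i|)); last first.
  by move=> v /setD1P[_]; apply: x_on iS _.
have card_K := cardsD1 u (K i); rewrite uK /= add1n in card_K.
rewrite sumr_const (x_on iS uK) (_ : #|K i :\ u| = #|K i|.-1) ?card_K //.
by rewrite -card_K clique_weight_eq // card_K.
Qed.

(** The neighbourhood sum is bounded below by a full clique [K i] plus a single vertex [w] of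
    another clique; [w] weighs least when its clique has [omega e] vertices. *)
Lemma lcp_residual_off u : (forall i, i \in S -> u \notin K i) ->
  0 <= lcp_residual e delta x u.
Proof.
move=> u_off; rewrite lcp_residualE (x_off u_off) add0r subr_ge0.
have [i iS full] := packing_full packK u_off.
have iK := packing_mem packK iS.
have [k /andP[kS neq_ki] [w wK e_uw]] := packing_second packK u_off iS (full i iK).
have wNK : w \notin K i.
  by apply: contraNN neq_ki => /(packing_inj (subxx S) packK kS iS wK)->.
(* The edge from [u] to [w] forces [omega e > 1], so the denominator of [gamma] is nonzero. *)
apply: le_trans (one_plus_clique_weight delta_gt0 (edge_omega_gt1 e_uw) gamma_le_delta) _.
rewrite ler_pM2l //.
apply: (@le_trans _ _ (\sum_(v in w |: K i) x v)); last first.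
  rewrite big_mkcond [leRHS]big_mkcond; apply: ler_sum => v _.
  rewrite in_setU1; case: ifP => [/orP[/eqP->|/full->]//|_]; first by rewrite e_uw.
  by case: ifP => // _; apply: x_ge0.
rewrite big_setU1 //= [leLHS]addrC lerD //.
  rewrite (x_on kS wK) clique_weight_anti //.
  rewrite clique_card_le ?(packing_clique (subxx S) packK kS) // andbT.
  by apply/card_gt0P; exists w.
rewrite (eq_bigr _ (x_on iS)) sumr_const clique_weight_total_ge1 //.
by apply/card_gt0P; exists i.
Qed.

Lemma packing_LCP_solution : LCP_solution e delta x.
Proof.
split; first exact: x_ge0.
  move=> u; case: (packing_case u) => [[i iS uK]|]; last exact: lcp_residual_off.
  by rewrite (lcp_residual_on iS uK).
apply: big1 => u _; case: (packing_case u) => [[i iS uK]|/x_off->].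
  by rewrite (lcp_residual_on iS uK) mulr0.
by rewrite mul0r.
Qed.

End Solution.
End Packing.

Theorem theorem4p6 (R : realType) (V : finType) (e : rel V)
    (e_sym : symmetric e) (e_irr : irreflexive e)
    (delta : R) (delta_gt0 : 0 < delta)
    (gamma_le_delta : gamma R e <= delta) (delta_lt1 : delta < 1)
    (S : {set V}) (S_max : maximum_independent_set e S)
    (s : seq V) (s_label : perm_eq s (enum S)) :
  let x := procedure e delta S s in
  independent_clique_solution e delta x /\
  exists P : {set {set V}},
    [/\ independent_cliques e P, supp x = cover P & #|P| = alpha e].
Proof.
have [K [packK x_on x_off]] := procedure_packing e_sym S_max delta s_label.
move=> x.
have cliques := independent_cliques_packing e_sym e_irr S_max packK.
have suppE := supp_cover delta_gt0 x_on x_off.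
have cardE := card_packing e_sym S_max packK.
split; last by exists (K @: S).
split; last by exists (K @: S).
by apply: (packing_LCP_solution e_sym e_irr S_max _ _ _ packK).
Qed.
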